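(* Let $(\mathcal C,\otimes,1,K)$ be a GV-category and let $(\mathcal M,\triangleright)$ be a left GV-module category over $\mathcal C$. For every $c\in\mathcal C$ fix a right adjoint $H_c\colon\mathcal M\to\mathcal M$ of the functor $c\triangleright{-}\colon\mathcal M\to\mathcal M$. Then the bifunctor $\blacktriangleright\colon\mathcal C\times\mathcal M\to\mathcal M$ defined by $$c\blacktriangleright m := H_{Gc}(m)\qquad (c\in\mathcal C,\ m\in\mathcal M)$$ has a left adjoint (and thus preserves limits, and is in particular continuous) in each variable, and it defines the structure of a left module category over the monoidal category $(\mathcal C,\odot,K)$ on $\mathcal M$.
   Context: A Grothendieck-Verdier category (GV-category) is a monoidal category $(\mathcal C,\otimes,1)$ together with a chosen object $K\in\mathcal C$ (the dualizing object) such that for every $y\in\mathcal C$ the functor $x\mapsto \mathrm{Hom}(x\otimes y,K)$ is representable by some object $Gy$, i.e. there are natural isomorphisms $\varpi_{x,y}\colon\mathrm{Hom}(x\otimes y,K)\cong\mathrm{Hom}(x,Gy)$, and such that the resulting contravariant functor $G\colon\mathcal C\to\mathcal C$ is an anti-equivalence. $G^{-1}$ denotes a quasi-inverse. The second tensor product is $x\odot y:=G^{-1}(Gy\otimes Gx)$; it is a monoidal structure on $\mathcal C$ with unit $K$ and with associator and unitors obtained by applying $G^{-1}$ to those of $\otimes$. A left GV-module category over $\mathcal C$ is a left module category $(\mathcal M,\triangleright)$ over the monoidal category $(\mathcal C,\otimes)$ such that for all $c\in\mathcal C$ and $m\in\mathcal M$ the functors $c\triangleright{-}\colon\mathcal M\to\mathcal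 M$ and ${-}\triangleright m\colon\mathcal C\to\mathcal M$ have right adjoints. The dependence of $H_{Gc}$ on $c$ is functorial via the induced natural transformations between adjoints. Categories are arbitrary; if they are linear over a field then all functors and actions are assumed (bi)linear. *)

(* Defs.v *)
From mathcomp Require Import all_boot all_algebra.

Set Implicit Arguments.
Unset Strict Implicit.
Unset Printing Implicit Defensive.

Declare Scope cat_scope.
Delimit Scope cat_scope with cat.
Local Open Scope cat_scope.

Record category := Category {
  Ob :> Type;
  Hom : Ob -> Ob -> Type;
  idm : forall x, Hom x x;
  comp : forall x y z, Hom y z -> Hom x y -> Hom x z;
  compA : forall x y z w (h : Hom z w) (g : Hom y z) (f : Hom x y),
    comp h (comp g f) = comp (comp h g) f;
  comp1m : forall x y (f : Hom x y), comp (idm y) f = f;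
  compm1 : forall x y (f : Hom x y), comp f (idm x) = f
}.
Arguments Hom {c} x y.
Arguments idm {c} x.
Arguments comp {c x y z} g f.
Notation "g ∘ f" := (comp g f) (at level 40, left associativity) : cat_scope.

Record iso (C : category) (x y : C) := Iso {
  fwd :> Hom x y;
  bwd : Hom y x;
  fwdK : bwd ∘ fwd = idm x;
  bwdK : fwd ∘ bwd = idm y
}.

Record functor (C D : category) := Functor {
  fobj :> C -> D;
  fmap : forall x y : C, Hom x y -> Hom (fobj x) (fobj y);
  fmap1 : forall x, fmap (idm x) = idm (fobj x);
  fmapM : forall x y z (g : Hom y z) (f : Hom x y),
    fmap (g ∘ f) = fmap g ∘ fmap f
}.
Arguments fmap {C D} _ {x y} _.

Definition op (C : category) : category :=
  @Category C (fun x y => @Hom C y x) (fun x => idm x)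
    (fun x y z g f => @comp C z y x f g)
    (fun x y z w h g f => esym (compA f g h))
    (fun x y f => compm1 f) (fun x y f => comp1m f).

Section Product.
Variables C D : category.

Let hom (p q : C * D) : Type := (Hom p.1 q.1 * Hom p.2 q.2)%type.
Let id_ p : hom p p := (idm p.1, idm p.2).
Let comp_ p q r (g : hom q r) (f : hom p q) : hom p r :=
  (g.1 ∘ f.1, g.2 ∘ f.2).

Fact prod_compA p q r s (h : hom r s) (g : hom q r) (f : hom p q) :
  comp_ h (comp_ g f) = comp_ (comp_ h g) f.
Proof. by rewrite /comp_ /= !compA. Qed.

Fact prod_comp1m p q (f : hom p q) : comp_ (id_ q) f = f.
Proof. by case: f => f g; rewrite /comp_ /= !comp1m. Qed.

Fact prod_compm1 p q (f : hom p q) : comp_ f (id_ p) = f.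
Proof. by case: f => f g; rewrite /comp_ /= !compm1. Qed.

Definition prod_cat : category :=
  Category prod_compA prod_comp1m prod_compm1.
End Product.
Canonical prod_cat.

Notation bifunctor C D E := (functor (prod_cat C D) E).

Local Obligation Tactic := idtac.

Section Functors.
Variables C D E : category.

Program Definition functor_comp (G : functor D E) (F : functor C D) :
    functor C E :=
  @Functor C E (fun x => G (F x)) (fun x y f => fmap G (fmap F f)) _ _.
Next Obligation. by move=> * /=; rewrite !fmap1. Qed.
Next Obligation. by move=> * /=; rewrite !fmapM. Qed.

Definition bimap (T : bifunctor C D E) (a a' : C) (b b' : D)
    (f : Hom a a') (g : Hom b b') : Hom (T (a, b)) (T (a', b')) :=
  @fmap _ _ T (a, b) (a', b') (f, g).

Lemma bimap1 (T : bifunctor C D E) a b :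
  bimap T (idm a) (idm b) = idm (T (a, b)).
Proof. exact: (fmap1 T (a, b)). Qed.

Lemma bimapM (T : bifunctor C D E) a a' a'' b b' b''
    (f' : Hom a' a'') (f : Hom a a') (g' : Hom b' b'') (g : Hom b b') :
  bimap T (f' ∘ f) (g' ∘ g) = bimap T f' g' ∘ bimap T f g.
Proof. exact: (@fmapM _ _ T (a, b) (a', b') (a'', b'') (f', g') (f, g)). Qed.

Program Definition section_l (T : bifunctor C D E) (c : C) : functor D E :=
  @Functor D E (fun d => T (c, d)) (fun d d' g => bimap T (idm c) g) _ _.
Next Obligation. by move=> * /=; rewrite bimap1. Qed.
Next Obligation. by move=> * /=; rewrite -bimapM comp1m. Qed.

Program Definition section_r (T : bifunctor C D E) (d : D) : functor C E :=
  @Functor C E (fun c => T (c, d)) (fun c c' f => bimap T f (idm d)) _ _.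
Next Obligation. by move=> * /=; rewrite bimap1. Qed.
Next Obligation. by move=> * /=; rewrite -bimapM comp1m. Qed.

End Functors.

(* [adjunction L R] : L is left adjoint to R *)
Record adjunction (C D : category) (L : functor C D) (R : functor D C) :=
  Adjunction {
  adj_unit : forall x : C, Hom x (R (L x));
  adj_counit : forall y : D, Hom (L (R y)) y;
  adj_unit_nat : forall (x x' : C) (f : Hom x x'),
    adj_unit x' ∘ f = fmap R (fmap L f) ∘ adj_unit x;
  adj_counit_nat : forall (y y' : D) (g : Hom y y'),
    adj_counit y' ∘ fmap L (fmap R g) = g ∘ adj_counit y;
  adj_triangle_l : forall x : C,
    adj_counit (L x) ∘ fmap L (adj_unit x) = idm (L x);
  adj_triangle_r : forall y : D,
    fmap R (adj_counit y) ∘ adj_unit (R y) = idm (R y)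
}.

Definition has_right_adjoint (C D : category) (L : functor C D) : Prop :=
  exists R : functor D C, inhabited (adjunction L R).

Definition has_left_adjoint (C D : category) (R : functor D C) : Prop :=
  exists L : functor C D, inhabited (adjunction L R).

Record quasi_inverse (A B : category) (G : functor A B) := QuasiInverse {
  qi_fun :> functor B A;
  qi_unit : forall x : A, iso x (qi_fun (G x));
  qi_counit : forall y : B, iso (G (qi_fun y)) y;
  qi_unit_nat : forall (x x' : A) (f : Hom x x'),
    qi_unit x' ∘ f = fmap qi_fun (fmap G f) ∘ qi_unit x;
  qi_counit_nat : forall (y y' : B) (g : Hom y y'),
    qi_counit y' ∘ fmap G (fmap qi_fun g) = g ∘ qi_counit y
}.

Definition is_equivalence (A B : category) (G : functor A B) : Prop :=
  inhabited (quasi_inverse G).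

Record cone (J C : category) (D : functor J C) (L : C) := Cone {
  leg : forall j : J, Hom L (D j);
  leg_nat : forall (i j : J) (u : Hom i j), fmap D u ∘ leg i = leg j
}.

Definition is_limit (J C : category) (D : functor J C) (L : C)
    (p : cone D L) : Prop :=
  forall (X : C) (q : cone D X),
    exists! h : Hom X L, forall j : J, leg p j ∘ h = leg q j.

Program Definition map_cone (J C C' : category) (F : functor C C')
    (D : functor J C) (L : C) (p : cone D L) : cone (functor_comp F D) (F L) :=
  @Cone J C' (functor_comp F D) (F L) (fun j => fmap F (leg p j)) _.
Next Obligation. by move=> * /=; rewrite -fmapM leg_nat. Qed.

Definition preserves_limits (C C' : category) (F : functor C C') : Prop :=
  forall (J : category) (D : functor J C) (L : C) (p : cone D L),
    is_limit p -> is_limit (map_cone F p).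

Record monoidal (C : category) := Monoidal {
  tensor : bifunctor C C C;
  unit_ob : C;
  assoc : forall x y z : C,
    iso (tensor (tensor (x, y), z)) (tensor (x, tensor (y, z)));
  lunit : forall x : C, iso (tensor (unit_ob, x)) x;
  runit : forall x : C, iso (tensor (x, unit_ob)) x;
  assoc_nat : forall (x x' y y' z z' : C)
      (f : Hom x x') (g : Hom y y') (h : Hom z z'),
    assoc x' y' z' ∘ bimap tensor (bimap tensor f g) h
    = bimap tensor f (bimap tensor g h) ∘ assoc x y z;
  lunit_nat : forall (x x' : C) (f : Hom x x'),
    lunit x' ∘ bimap tensor (idm unit_ob) f = f ∘ lunit x;
  runit_nat : forall (x x' : C) (f : Hom x x'),
    runit x' ∘ bimap tensor f (idm unit_ob) = f ∘ runit x;
  pentagon : forall x y z w : C,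
    assoc x y (tensor (z, w)) ∘ assoc (tensor (x, y)) z w
    = bimap tensor (idm x) (assoc y z w)
      ∘ assoc x (tensor (y, z)) w ∘ bimap tensor (assoc x y z) (idm w);
  triangle : forall x y : C,
    bimap tensor (idm x) (lunit y) ∘ assoc x unit_ob y
    = bimap tensor (runit x) (idm y)
}.

Record module_structure (C : category) (V : monoidal C) (M : category)
    (act : bifunctor C M M) := ModuleStructure {
  mod_assoc : forall (c d : C) (m : M),
    iso (act (tensor V (c, d), m)) (act (c, act (d, m)));
  mod_unit : forall m : M, iso (act (unit_ob V, m)) m;
  mod_assoc_nat : forall (c c' d d' : C) (m m' : M)
      (f : Hom c c') (g : Hom d d') (h : Hom m m'),
    mod_assoc c' d' m' ∘ bimap act (bimap (tensor V) f g) h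
    = bimap act f (bimap act g h) ∘ mod_assoc c d m;
  mod_unit_nat : forall (m m' : M) (h : Hom m m'),
    mod_unit m' ∘ bimap act (idm (unit_ob V)) h = h ∘ mod_unit m;
  mod_pentagon : forall (b c d : C) (m : M),
    mod_assoc b c (act (d, m)) ∘ mod_assoc (tensor V (b, c)) d m
    = bimap act (idm b) (mod_assoc c d m)
      ∘ mod_assoc b (tensor V (c, d)) m
      ∘ bimap act (assoc V b c d) (idm m);
  mod_triangle : forall (c : C) (m : M),
    bimap act (idm c) (mod_unit m) ∘ mod_assoc c (unit_ob V) m
    = bimap act (runit V c) (idm m)
}.

Section IsoTheory.
Variable C : category.

Lemma iso_inj (x y z : C) (i : iso y z) (f g : Hom x y) :
  i ∘ f = i ∘ g -> f = g.
Proof.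
by move=> e; rewrite -[f]comp1m -[g]comp1m -(fwdK i) -!compA e.
Qed.

Lemma iso_nat_bwd (x x' y y' : C) (i : iso x y) (i' : iso x' y')
    (f : Hom x x') (g : Hom y y') :
  i' ∘ f = g ∘ i -> f ∘ bwd i = bwd i' ∘ g.
Proof.
move=> e; apply: (iso_inj (i := i')).
by rewrite !compA e bwdK comp1m -compA bwdK compm1.
Qed.

Definition iso_id (x : C) : iso x x :=
  @Iso C x x (idm x) (idm x) (comp1m _) (comp1m _).

Definition iso_sym (x y : C) (i : iso x y) : iso y x :=
  @Iso C y x (bwd i) i (bwdK i) (fwdK i).

Program Definition iso_comp (x y z : C) (j : iso y z) (i : iso x y) :
    iso x z :=
  @Iso C x z (j ∘ i) (bwd i ∘ bwd j) _ _.
Next Obligation.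
by move=> x y z j i /=; rewrite -compA (compA (bwd j)) fwdK comp1m fwdK.
Qed.
Next Obligation.
by move=> x y z j i /=; rewrite -compA (compA (i : Hom _ _)) bwdK comp1m bwdK.
Qed.

Definition iso_op (x y : C) (i : iso x y) : @iso (op C) y x :=
  @Iso (op C) y x i (bwd i) (bwdK i) (fwdK i).

Program Definition iso_fmap (D : category) (F : functor C D) (x y : C)
    (i : iso x y) : iso (F x) (F y) :=
  @Iso D _ _ (fmap F i) (fmap F (bwd i)) _ _.
Next Obligation. by move=> * /=; rewrite -fmapM fwdK fmap1. Qed.
Next Obligation. by move=> * /=; rewrite -fmapM bwdK fmap1. Qed.

Program Definition iso_bimap (D E : category) (T : bifunctor C D E)
    (a a' : C) (b b' : D) (i : iso a a') (j : iso b b') :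
    iso (T (a, b)) (T (a', b')) :=
  @Iso E _ _ (bimap T i j) (bimap T (bwd i) (bwd j)) _ _.
Next Obligation. by move=> * /=; rewrite -bimapM !fwdK bimap1. Qed.
Next Obligation. by move=> * /=; rewrite -bimapM !bwdK bimap1. Qed.

End IsoTheory.

Section Equivalence.
Variables (A B : category) (G : functor A B) (Q : quasi_inverse G).

(* [qi_unit] and [qi_counit] are unrelated; this modification of [qi_unit]
   satisfies the triangle identity [qi_triangle] with [qi_counit], and equals
   [qi_unit] if the latter already does. *)
Definition qi_unit_adj (x : A) : iso x (Q (G x)) :=
  iso_comp (iso_sym (qi_unit Q (Q (G x))))
    (iso_comp (iso_fmap Q (iso_sym (qi_counit Q (G x)))) (qi_unit Q x)).

Lemma qi_unit_counit (x : A) :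
  qi_unit Q (Q (G x)) = fmap Q (fmap G (qi_unit Q x)) :> Hom _ _.
Proof.
have h := qi_unit_nat Q (qi_unit Q x).
by rewrite -[LHS]compm1 -(bwdK (qi_unit Q x)) compA h -compA bwdK compm1.
Qed.

Lemma qi_triangle (x : A) :
  qi_counit Q (G x) ∘ fmap G (qi_unit_adj x) = idm (G x).
Proof.
have key : bwd (qi_unit Q (Q (G x))) = fmap Q (fmap G (bwd (qi_unit Q x))).
  apply: (iso_inj (i := qi_unit Q (Q (G x)))).
  by rewrite bwdK qi_unit_counit -!fmapM bwdK !fmap1.
rewrite /= key !fmapM !compA qi_counit_nat.
rewrite -(compA (fmap G _) (qi_counit Q _) (fmap G _)) qi_counit_nat.
by rewrite fwdK compm1 -fmapM fwdK fmap1.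
Qed.

Lemma qi_unit_adjE (x : A) :
  fmap G (bwd (qi_unit_adj x)) = qi_counit Q (G x).
Proof.
rewrite -[RHS]compm1 -(fmap1 G) -(bwdK (qi_unit_adj x)) fmapM compA.
by rewrite qi_triangle comp1m.
Qed.

Lemma qi_full (x y : A) (h : Hom (G x) (G y)) :
  fmap G (bwd (qi_unit_adj y) ∘ fmap Q h ∘ qi_unit_adj x) = h.
Proof.
by rewrite fmapM (fmapM G (bwd _) (fmap Q h)) qi_unit_adjE qi_counit_nat -compA qi_triangle compm1.
Qed.

Lemma qi_counit_bwd_nat (y y' : B) (g : Hom y y') :
  fmap G (fmap Q g) ∘ bwd (qi_counit Q y) = bwd (qi_counit Q y') ∘ g.
Proof.
by apply: iso_nat_bwd; exact: qi_counit_nat.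
Qed.

End Equivalence.

Section Transport.
Variables (A B : category) (G : functor A B) (Q : quasi_inverse G).
Variables (W : monoidal B) (k : A) (u : iso (G k) (unit_ob W)).

Local Notation "X ⊗ Y" := (tensor W (X, Y)) (at level 40, left associativity).
Local Notation "f ⊠ g" := (bimap (tensor W) f g)
  (at level 40, left associativity).
Local Notation ε := (qi_counit Q).

Program Definition tr_tensor : bifunctor A A A :=
  @Functor (prod_cat A A) A (fun p => Q (G p.1 ⊗ G p.2))
    (fun p q f => fmap Q (fmap G f.1 ⊠ fmap G f.2)) _ _.
Next Obligation. by move=> p /=; rewrite !fmap1 bimap1 fmap1. Qed.
Next Obligation. by move=> p q r g f /=; rewrite !fmapM bimapM fmapM. Qed.

Definition tr_assoc_aux (x y z : A) :
    iso (G (Q (G x ⊗ G y)) ⊗ G z) (G x ⊗ G (Q (G y ⊗ G z))) :=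
  iso_comp (iso_bimap (tensor W) (iso_id (G x)) (iso_sym (ε (G y ⊗ G z))))
    (iso_comp (assoc W (G x) (G y) (G z))
      (iso_bimap (tensor W) (ε (G x ⊗ G y)) (iso_id (G z)))).

Definition tr_lunit_aux (x : A) : iso (G k ⊗ G x) (G x) :=
  iso_comp (lunit W (G x)) (iso_bimap (tensor W) u (iso_id (G x))).

Definition tr_runit_aux (x : A) : iso (G x ⊗ G k) (G x) :=
  iso_comp (runit W (G x)) (iso_bimap (tensor W) (iso_id (G x)) u).

Definition tr_assoc (x y z : A) :
    iso (tr_tensor (tr_tensor (x, y), z)) (tr_tensor (x, tr_tensor (y, z))) :=
  iso_fmap Q (tr_assoc_aux x y z).

Definition tr_lunit (x : A) : iso (tr_tensor (k, x)) x :=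
  iso_comp (iso_sym (qi_unit_adj Q x)) (iso_fmap Q (tr_lunit_aux x)).

Definition tr_runit (x : A) : iso (tr_tensor (x, k)) x :=
  iso_comp (iso_sym (qi_unit_adj Q x)) (iso_fmap Q (tr_runit_aux x)).

Lemma tensorM1 X X' X'' Y (f : Hom X' X'') (g : Hom X X') :
  (f ∘ g) ⊠ idm Y = (f ⊠ idm Y) ∘ (g ⊠ idm Y).
Proof. by rewrite -bimapM comp1m. Qed.

Lemma tensor1M X X' X'' Y (f : Hom X' X'') (g : Hom X X') :
  idm Y ⊠ (f ∘ g) = (idm Y ⊠ f) ∘ (idm Y ⊠ g).
Proof. by rewrite -bimapM comp1m. Qed.

Lemma tensor_xchg X X' Y Y' (f : Hom X X') (g : Hom Y Y') :
  (f ⊠ idm Y') ∘ (idm X ⊠ g) = (idm X' ⊠ g) ∘ (f ⊠ idm Y).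
Proof. by rewrite -!bimapM !comp1m !compm1. Qed.

Lemma tr_assoc_aux_nat x x' y y' z z'
    (f : Hom x x') (g : Hom y y') (h : Hom z z') :
  tr_assoc_aux x' y' z' ∘ (fmap G (fmap Q (fmap G f ⊠ fmap G g)) ⊠ fmap G h)
  = (fmap G f ⊠ fmap G (fmap Q (fmap G g ⊠ fmap G h))) ∘ tr_assoc_aux x y z.
Proof.
rewrite /= -!compA -bimapM qi_counit_nat comp1m.
have -> : (fmap G f ⊠ fmap G g ∘ ε (G x ⊗ G y)) ⊠ fmap G h
  = (fmap G f ⊠ fmap G g ⊠ fmap G h) ∘ (ε (G x ⊗ G y) ⊠ idm (G z)).
  by rewrite -bimapM compm1.
rewrite (compA (assoc _ _ _ _ : Hom _ _)) assoc_nat !compA -!bimapM.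
by rewrite comp1m compm1 qi_counit_bwd_nat.
Qed.

Lemma tr_assoc_nat (x x' y y' z z' : A)
    (f : Hom x x') (g : Hom y y') (h : Hom z z') :
  tr_assoc x' y' z' ∘ bimap tr_tensor (bimap tr_tensor f g) h
  = bimap tr_tensor f (bimap tr_tensor g h) ∘ tr_assoc x y z.
Proof. by rewrite /bimap /= -!fmapM; congr (fmap Q _); exact: tr_assoc_aux_nat. Qed.

Lemma qi_unit_adj_nat (x x' : A) (f : Hom x x') :
  f ∘ bwd (qi_unit_adj Q x)
  = bwd (qi_unit_adj Q x') ∘ fmap Q (fmap G f).
Proof.
apply: iso_nat_bwd; rewrite /= -!compA qi_unit_nat !compA.
rewrite (iso_nat_bwd (qi_unit_nat Q (fmap Q (fmap G f)))).
rewrite -!(compA (bwd _)) -!fmapM qi_counit_bwd_nat.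
by [].
Qed.

Lemma tr_lunit_nat (x x' : A) (f : Hom x x') :
  tr_lunit x' ∘ bimap tr_tensor (idm k) f = f ∘ tr_lunit x.
Proof.
rewrite [RHS]compA qi_unit_adj_nat -!compA; congr (_ ∘ _).
rewrite /bimap /= -!fmapM; congr (_ ∘ (_ ∘ fmap Q _)).
rewrite compA -lunit_nat -!compA fmap1 -!bimapM.
by rewrite !comp1m !compm1.
Qed.

Lemma tr_runit_nat (x x' : A) (f : Hom x x') :
  tr_runit x' ∘ bimap tr_tensor f (idm k) = f ∘ tr_runit x.
Proof.
rewrite [RHS]compA qi_unit_adj_nat -!compA; congr (_ ∘ _).
rewrite /bimap /= -!fmapM; congr (_ ∘ (_ ∘ fmap Q _)).
rewrite compA -runit_nat -!compA fmap1 -!bimapM.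
by rewrite !comp1m !compm1.
Qed.

Lemma tr_pentagon (x y z w : A) :
  tr_assoc x y (tr_tensor (z, w)) ∘ tr_assoc (tr_tensor (x, y)) z w
  = bimap tr_tensor (idm x) (tr_assoc y z w)
    ∘ tr_assoc x (tr_tensor (y, z)) w
    ∘ bimap tr_tensor (tr_assoc x y z) (idm w).
Proof.
rewrite /bimap /= -!fmapM; congr (fmap Q _); rewrite !fmap1.
change ((tr_assoc_aux x y (tr_tensor (z, w)) : Hom _ _)
    ∘ tr_assoc_aux (tr_tensor (x, y)) z w
  = (idm (G x) ⊠ fmap G (fmap Q (tr_assoc_aux y z w)))
    ∘ tr_assoc_aux x (tr_tensor (y, z)) w
    ∘ (fmap G (fmap Q (tr_assoc_aux x y z)) ⊠ idm (G w))).
pose al X Y Z : Hom (X ⊗ Y ⊗ Z) (X ⊗ (Y ⊗ Z)) := assoc W X Y Z.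
pose e X : Hom (G (Q X)) X := ε X.
pose e' X : Hom X (G (Q X)) := bwd (ε X).
have alN X X' Y Y' Z Z' (f : Hom X X') (g : Hom Y Y') (h : Hom Z Z') :
    al X' Y' Z' ∘ (f ⊠ g ⊠ h) = (f ⊠ (g ⊠ h)) ∘ al X Y Z := assoc_nat W f g h.
have auxE a b c : tr_assoc_aux a b c
  = (idm (G a) ⊠ e' _) ∘ (al (G a) (G b) (G c) ∘ (e _ ⊠ idm (G c)))
  :> Hom _ _ by [].
have eN X X' (f : Hom X X') : e X' ∘ fmap G (fmap Q f) = f ∘ e X
  := qi_counit_nat Q f.
have e'N X X' (f : Hom X X') : fmap G (fmap Q f) ∘ e' X = e' X' ∘ f
  := qi_counit_bwd_nat Q f.
have ee' X : e X ∘ e' X = idm X := bwdK (ε X).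
(* both sides become (1 ⊠ (e' ∘ (1 ⊠ e'))) ∘ (..) ∘ (((e ⊠ 1) ∘ e) ⊠ 1) *)
have L : tr_assoc_aux x y (tr_tensor (z, w))
    ∘ tr_assoc_aux (tr_tensor (x, y)) z w
  = (idm (G x) ⊠ e' (G y ⊗ G (Q (G z ⊗ G w))))
    ∘ (idm (G x) ⊠ (idm (G y) ⊠ e' (G z ⊗ G w)))
    ∘ (al (G x) (G y) (G z ⊗ G w) ∘ al (G x ⊗ G y) (G z) (G w))
    ∘ ((e (G x ⊗ G y) ⊠ idm (G z)) ⊠ idm (G w))
    ∘ (e (G (Q (G x ⊗ G y)) ⊗ G z) ⊠ idm (G w)).
  rewrite !auxE -!compA; congr (_ ∘ _); rewrite [RHS]compA -alN -!compA.
  congr (_ ∘ _); rewrite bimap1 [in RHS](compA (al _ _ _)).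
  rewrite alN -[in RHS]compA ![LHS]compA ![RHS]compA; congr (_ ∘ _ ∘ _).
  by rewrite bimap1 tensor_xchg.
have R : (idm (G x) ⊠ fmap G (fmap Q (tr_assoc_aux y z w)))
    ∘ tr_assoc_aux x (tr_tensor (y, z)) w
    ∘ (fmap G (fmap Q (tr_assoc_aux x y z)) ⊠ idm (G w))
  = (idm (G x) ⊠ e' _) ∘ ((idm (G x) ⊠ tr_assoc_aux y z w)
    ∘ al (G x) (G (tr_tensor (y, z))) (G w)
    ∘ (tr_assoc_aux x y z ⊠ idm (G w))) ∘ (e _ ⊠ idm (G w)).
  rewrite (auxE x) !compA -[in LHS]tensor1M (e'N _ _ (tr_assoc_aux y z w : Hom _ _)).
  rewrite [in LHS]tensor1M -!compA; do 3 congr (_ ∘ _).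
  by rewrite -!tensorM1 (eN _ _ (tr_assoc_aux x y z : Hom _ _)).
have M : (idm (G x) ⊠ tr_assoc_aux y z w)
    ∘ al (G x) (G (tr_tensor (y, z))) (G w)
    ∘ (tr_assoc_aux x y z ⊠ idm (G w))
  = (idm (G x) ⊠ (idm (G y) ⊠ e' (G z ⊗ G w)))
    ∘ ((idm (G x) ⊠ al (G y) (G z) (G w)) ∘ al (G x) (G y ⊗ G z) (G w)
      ∘ (al (G x) (G y) (G z) ⊠ idm (G w)))
    ∘ ((e (G x ⊗ G y) ⊠ idm (G z)) ⊠ idm (G w)).
  rewrite !auxE !tensor1M !tensorM1 -!compA; do 2 congr (_ ∘ _).
  rewrite !compA; do 2 congr (_ ∘ _).
  by rewrite -alN -compA -!tensorM1 -tensor1M ee' !bimap1 compm1.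
rewrite L R M -!compA; do 2 congr (_ ∘ _); rewrite !compA.
by do 2 congr (_ ∘ _); rewrite /al pentagon.
Qed.

Lemma tr_triangle (x y : A) :
  bimap tr_tensor (idm x) (tr_lunit y) ∘ tr_assoc x k y
  = bimap tr_tensor (tr_runit x) (idm y).
Proof.
have El : fmap G (tr_lunit y) = tr_lunit_aux y ∘ ε (G k ⊗ G y).
  by rewrite fmapM qi_unit_adjE qi_counit_nat.
have Er : fmap G (tr_runit x) = tr_runit_aux x ∘ ε (G x ⊗ G k).
  by rewrite fmapM qi_unit_adjE qi_counit_nat.
transitivity (fmap Q ((fmap G (idm x) ⊠ fmap G (tr_lunit y))
  ∘ tr_assoc_aux x k y)); first by rewrite fmapM.
transitivity (fmap Q (fmap G (tr_runit x) ⊠ fmap G (idm y))); last by [].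
rewrite !fmap1 El Er; congr (fmap Q _).
rewrite /= !compA -tensor1M -[_ ∘ bwd _]compA bwdK compm1.
rewrite tensor1M -(compA (_ ⊠ lunit _ _)) -assoc_nat compA triangle.
by rewrite -!tensorM1.
Qed.

Definition transport_monoidal : monoidal A :=
  Monoidal tr_assoc_nat tr_lunit_nat tr_runit_nat tr_pentagon tr_triangle.

End Transport.

Section Revop.
Variables (C : category) (V : monoidal C).

Program Definition ro_tensor : bifunctor (op C) (op C) (op C) :=
  @Functor (prod_cat (op C) (op C)) (op C) (fun p => tensor V (p.2, p.1))
    (fun p q f => @bimap C C C (tensor V) _ _ _ _ f.2 f.1) _ _.
Next Obligation. by move=> p /=; rewrite bimap1. Qed.
Next Obligation. by move=> p q r g f /=; rewrite bimapM. Qed.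

Definition ro_assoc (x y z : op C) :
    iso (ro_tensor (ro_tensor (x, y), z)) (ro_tensor (x, ro_tensor (y, z))) :=
  iso_op (assoc V z y x).

Definition ro_lunit (x : op C) : @iso (op C) (ro_tensor (unit_ob V, x)) x :=
  iso_op (iso_sym (runit V x)).

Definition ro_runit (x : op C) : @iso (op C) (ro_tensor (x, unit_ob V)) x :=
  iso_op (iso_sym (lunit V x)).

Lemma ro_assoc_nat (x x' y y' z z' : op C)
    (f : Hom x x') (g : Hom y y') (h : Hom z z') :
  ro_assoc x' y' z' ∘ bimap ro_tensor (bimap ro_tensor f g) h
  = bimap ro_tensor f (bimap ro_tensor g h) ∘ ro_assoc x y z.
Proof. exact: esym (@assoc_nat C V z' z y' y x' x h g f). Qed.

Lemma ro_lunit_nat (x x' : op C) (f : Hom x x') :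
  ro_lunit x' ∘ bimap ro_tensor (idm (unit_ob V : op C)) f = f ∘ ro_lunit x.
Proof. exact: iso_nat_bwd (@runit_nat C V x' x f). Qed.

Lemma ro_runit_nat (x x' : op C) (f : Hom x x') :
  ro_runit x' ∘ bimap ro_tensor f (idm (unit_ob V : op C)) = f ∘ ro_runit x.
Proof. exact: iso_nat_bwd (@lunit_nat C V x' x f). Qed.

Lemma ro_pentagon (x y z w : op C) :
  ro_assoc x y (ro_tensor (z, w)) ∘ ro_assoc (ro_tensor (x, y)) z w
  = bimap ro_tensor (idm x) (ro_assoc y z w)
    ∘ ro_assoc x (ro_tensor (y, z)) w
    ∘ bimap ro_tensor (ro_assoc x y z) (idm w).
Proof.
have e := @pentagon C V w z y x; rewrite -compA in e; exact: e.
Qed.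

Lemma ro_triangle (x y : op C) :
  bimap ro_tensor (idm x) (ro_lunit y) ∘ ro_assoc x (unit_ob V : op C) y
  = bimap ro_tensor (ro_runit x) (idm y).
Proof.
change (@assoc C V y (unit_ob V) x
    ∘ @bimap C C C (tensor V) _ _ _ _ (bwd (runit V y)) (@idm C x)
  = @bimap C C C (tensor V) _ _ _ _ (@idm C y) (bwd (lunit V x))).
apply: (iso_inj (i := iso_bimap (tensor V) (iso_id (y : C)) (lunit V x))).
rewrite compA [X in X ∘ _]triangle.
by rewrite /= -!bimapM !bwdK !comp1m !bimap1.
Qed.

Definition revop_monoidal : monoidal (op C) :=
  Monoidal ro_assoc_nat ro_lunit_nat ro_runit_nat ro_pentagon ro_triangle.

End Revop.

(* A representation, for every y, of the presheaf Hom(- ⊗ y, K). *)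
Record duality (C : category) (V : monoidal C) (K : C) := Duality {
  dual_ob : C -> C;
  curry : forall x y : C, Hom (tensor V (x, y)) K -> Hom x (dual_ob y);
  uncurry : forall x y : C, Hom x (dual_ob y) -> Hom (tensor V (x, y)) K;
  curryK : forall x y, cancel (@curry x y) (@uncurry x y);
  uncurryK : forall x y, cancel (@uncurry x y) (@curry x y);
  curry_nat : forall (x x' y : C) (f : Hom x' x) (g : Hom (tensor V (x, y)) K),
    curry (g ∘ bimap (tensor V) f (idm y)) = curry g ∘ f
}.
Arguments curry {C V K} d {x y} _.
Arguments uncurry {C V K} d {x y} _.
Arguments curryK {C V K} d {x y}.
Arguments uncurryK {C V K} d {x y}.

Section Dual.
Variables (C : category) (V : monoidal C) (K : C) (D : duality V K).

Local Notation "x ⊗ y" := (tensor V (x, y)) (at level 40, left associativity).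
Local Notation "f ⊠ g" := (@bimap C C C (tensor V) _ _ _ _ f g)
  (at level 40, left associativity).
Local Notation G := (dual_ob D).

Definition ev (y : C) : Hom (G y ⊗ y) K := uncurry D (idm (G y)).

(* the unique map for which [curry] is also natural in its second variable *)
Definition dual_map (y y' : C) (f : Hom y y') : Hom (G y') (G y) :=
  curry D (ev y' ∘ (idm (G y') ⊠ f)).

Lemma uncurry_nat (x x' y : C) (f : Hom x' x) (g : Hom x (G y)) :
  uncurry D (g ∘ f) = uncurry D g ∘ (f ⊠ idm y).
Proof. by rewrite -[LHS](curryK D) uncurryK -{1}(uncurryK D g) -curry_nat curryK. Qed.

Lemma uncurryE (x y : C) (g : Hom x (G y)) :
  uncurry D g = ev y ∘ (g ⊠ idm y).
Proof. by rewrite -uncurry_nat comp1m. Qed.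

Lemma dual_mapE (y y' : C) (f : Hom y y') :
  ev y ∘ (dual_map f ⊠ idm y) = ev y' ∘ (idm (G y') ⊠ f).
Proof. by rewrite -uncurryE curryK. Qed.

Lemma dual_map1 (y : C) : dual_map (idm y) = idm (G y).
Proof. by rewrite /dual_map bimap1 compm1 uncurryK. Qed.

Lemma dual_mapM (y y' y'' : C) (g : Hom y' y'') (f : Hom y y') :
  dual_map (g ∘ f) = dual_map f ∘ dual_map g.
Proof.
rewrite -[RHS](uncurryK D) uncurry_nat uncurryE dual_mapE -compA -bimapM.
rewrite comp1m compm1; congr (curry D _).
have -> : dual_map g ⊠ f = (dual_map g ⊠ idm y') ∘ (idm _ ⊠ f).
  by rewrite -bimapM comp1m compm1.
by rewrite compA dual_mapE -compA -bimapM comp1m.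
Qed.

Definition dual : functor C (op C) :=
  @Functor C (op C) G dual_map dual_map1 dual_mapM.

Lemma curry_nat_r (x y y' : C) (f : Hom y y') (g : Hom (x ⊗ y') K) :
  curry D (g ∘ (idm x ⊠ f)) = dual_map f ∘ curry D g.
Proof.
rewrite -[RHS](uncurryK D) uncurry_nat uncurryE dual_mapE -compA -bimapM.
rewrite comp1m compm1 -{1}(curryK D g) uncurryE -compA -bimapM.
by rewrite comp1m compm1.
Qed.

Variable Q : quasi_inverse dual.

(* The comparison between 1 and GK is the map corresponding to the left unitor
   1 ⊗ K -> K; it is used to take K rather than G^-1 1 as unit of ⊙. *)
Definition one_to_dualK : Hom (unit_ob V) (G K) := curry D (lunit V K).

Let w : C := Q (unit_ob V : op C).
Let s : @iso (op C) (G w) (unit_ob V) := qi_counit Q (unit_ob V : op C).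
Let s_fwd : Hom (unit_ob V) (G w) := fwd s.
Let s_bwd : Hom (G w) (unit_ob V) := bwd s.
Let e : Hom w K := uncurry D s_fwd ∘ bwd (lunit V w).

Definition dualK_to_one : Hom (G K) (unit_ob V) := s_bwd ∘ dual_map e.

Let s_bf : s_bwd ∘ s_fwd = idm (unit_ob V) := bwdK s.
Let s_fb : s_fwd ∘ s_bwd = idm (G w) := fwdK s.

Let e_lunit : e ∘ lunit V w = uncurry D s_fwd.
Proof. by rewrite /e -compA fwdK compm1. Qed.

Let dual_e_one : dual_map e ∘ one_to_dualK = s_fwd.
Proof.
rewrite /one_to_dualK -curry_nat_r lunit_nat.
by rewrite e_lunit uncurryK.
Qed.

Fact dualK_oneK : dualK_to_one ∘ one_to_dualK = idm (unit_ob V).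
Proof. by rewrite /dualK_to_one -compA dual_e_one s_bf. Qed.

Fact one_dualKK : one_to_dualK ∘ dualK_to_one = idm (G K).
Proof.
have [g gE] : exists g : Hom K w, dual_map g = one_to_dualK ∘ s_bwd.
  by eexists; exact: (@qi_full _ _ dual Q K w (one_to_dualK ∘ s_bwd)).
have eg : e ∘ g = idm K.
  have h : e ∘ g ∘ lunit V K = idm K ∘ lunit V K.
    rewrite -compA -lunit_nat compA e_lunit comp1m.
    rewrite -[LHS](curryK D) curry_nat_r uncurryK gE -compA s_bf compm1.
    by rewrite curryK.
  by rewrite -[LHS]compm1 -(bwdK (lunit V K)) compA h -compA bwdK compm1.
have -> : one_to_dualK = dual_map g ∘ s_fwd.
  by rewrite gE -compA s_bf compm1.
by rewrite /dualK_to_one compA -(compA (dual_map g)) s_fb compm1 -dual_mapM eg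
           dual_map1.
Qed.

Definition dualK_iso : @iso (op C) (G K) (unit_ob V) :=
  @Iso (op C) (G K) (unit_ob V) one_to_dualK dualK_to_one
    one_dualKK dualK_oneK.

(* ⊙: seen in [op C] with the reversed product, G y ⊗ G x is the product of
   G x and G y; [second_monoidalE] gives x ⊙ y = G^-1 (G y ⊗ G x). *)
Definition second_monoidal : monoidal C :=
  @transport_monoidal C (op C) dual Q (revop_monoidal V) K dualK_iso.

Lemma second_monoidalE (x y : C) :
  tensor second_monoidal (x, y) = Q (G y ⊗ G x : op C).
Proof. by []. Qed.

End Dual.

Record GV_category := GVCategory {
  gv_cat :> category;
  gv_monoidal : monoidal gv_cat;
  gv_K : gv_cat;
  gv_duality : duality gv_monoidal gv_K;
  gv_antiequivalence : is_equivalence (dual gv_duality)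
}.

Definition gv_dual (C : GV_category) : functor C (op C) :=
  dual (gv_duality C).

Definition gv_second (C : GV_category) (Q : quasi_inverse (gv_dual C)) :
    monoidal C :=
  second_monoidal Q.

Record GV_module (C : GV_category) := GVModule {
  gvm_cat :> category;
  gvm_act : bifunctor C gvm_cat gvm_cat;
  gvm_structure : module_structure (gv_monoidal C) gvm_act;
  gvm_radj_l : forall c : C, has_right_adjoint (section_l gvm_act c);
  gvm_radj_r : forall m : gvm_cat, has_right_adjoint (section_r gvm_act m)
}.

Section RightAdjoints.
Variables (C M N : category) (act : bifunctor C M N).
Variable H : C -> functor N M.
Variable adj : forall c : C, adjunction (section_l act c) (H c).

(* the mate H_d => H_c of the natural transformation f |> - *)
Definition mate (c d : C) (f : Hom c d) (n : N) : Hom (H d n) (H c n) :=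
  fmap (H c) (adj_counit (adj d) n ∘ bimap act f (idm (H d n)))
  ∘ adj_unit (adj c) (H d n).

Lemma mate_counit c d (f : Hom c d) n :
  adj_counit (adj c) n ∘ bimap act (idm c) (mate f n)
  = adj_counit (adj d) n ∘ bimap act f (idm (H d n)).
Proof.
rewrite -[bimap act (idm c) _]/(fmap (section_l act c) (mate f n)) fmapM.
by rewrite compA adj_counit_nat -compA (adj_triangle_l (adj c) (H d n)) compm1.
Qed.

Lemma adj_ext c m n (f g : Hom m (H c n)) :
  adj_counit (adj c) n ∘ bimap act (idm c) f
  = adj_counit (adj c) n ∘ bimap act (idm c) g -> f = g.
Proof.
have E h : fmap (H c) (adj_counit (adj c) n ∘ bimap act (idm c) h)
    ∘ adj_unit (adj c) m = h.
  rewrite fmapM -compA.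
  rewrite -[X in _ ∘ X](adj_unit_nat (adj c) h).
  by rewrite compA adj_triangle_r comp1m.
by move=> e; rewrite -(E f) e E.
Qed.

Lemma mate1 c n : mate (idm c) n = idm (H c n).
Proof. by apply: adj_ext; rewrite mate_counit. Qed.

Lemma mateM b c d (g : Hom c d) (f : Hom b c) n :
  mate (g ∘ f) n = mate f n ∘ mate g n.
Proof.
apply: adj_ext; rewrite mate_counit.
transitivity (adj_counit (adj b) n ∘ bimap act (idm b) (mate f n)
    ∘ bimap act (idm b) (mate g n)).
  rewrite mate_counit -compA -bimapM comp1m compm1.
  have -> : bimap act f (mate g n)
    = bimap act (idm c) (mate g n) ∘ bimap act f (idm (H d n)).
    by rewrite -bimapM comp1m compm1.
  by rewrite compA mate_counit -compA -bimapM comp1m.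
by rewrite -compA -bimapM comp1m.
Qed.

Lemma mate_nat c d (f : Hom c d) n n' (h : Hom n n') :
  mate f n' ∘ fmap (H d) h = fmap (H c) h ∘ mate f n.
Proof.
have Ef k k' (g : Hom k k') d' : adj_counit (adj d') k'
    ∘ bimap act (idm d') (fmap (H d') g) = g ∘ adj_counit (adj d') k.
  exact: (adj_counit_nat (adj d') g).
apply: adj_ext.
have B m m' m'' (u : Hom m' m'') (v : Hom m m') : bimap act (idm c) (u ∘ v)
  = bimap act (idm c) u ∘ bimap act (idm c) v by rewrite -bimapM comp1m.
rewrite (B _ _ _ (mate f n')) (B _ _ _ (fmap (H c) h)) !compA mate_counit Ef -(compA h) mate_counit -compA -bimapM.
rewrite comp1m compm1 compA -Ef -compA -bimapM comp1m.
by rewrite compm1.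
Qed.

Program Definition radj_bifunctor : bifunctor (op C) N M :=
  @Functor (prod_cat (op C) N) M (fun p => H p.1 p.2)
    (fun p q f => fmap (H q.1) f.2 ∘ @mate q.1 p.1 f.1 p.2) _ _.
Next Obligation. by move=> p /=; rewrite fmap1 mate1 comp1m. Qed.
Next Obligation.
move=> p q r g f /=; rewrite mateM (fmapM (H r.1)) -[RHS]compA.
rewrite (compA (mate g.1 _) (fmap (H q.1) f.2)) mate_nat.
by rewrite -[LHS]compA -[in RHS](compA (fmap (H r.1) f.2)).
Qed.

End RightAdjoints.

Program Definition functor_id_r (C C' N : category) (G : functor C C') :
    functor (prod_cat C N) (prod_cat C' N) :=
  @Functor (prod_cat C N) (prod_cat C' N) (fun p => (G p.1, p.2))
    (fun p q f => (fmap G f.1, f.2)) _ _.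
Next Obligation. by move=> * /=; rewrite fmap1. Qed.
Next Obligation. by move=> * /=; rewrite fmapM. Qed.

(* The action c ▶ m = H_{Gc} m, see [black_actionE]. *)
Definition black_action (C : GV_category) (M : GV_module C)
    (H : C -> functor M M)
    (adj : forall c : C, adjunction (section_l (gvm_act M) c) (H c)) :
    bifunctor C M M :=
  functor_comp (radj_bifunctor adj) (functor_id_r M (gv_dual C)).

Lemma black_actionE (C : GV_category) (M : GV_module C)
    (H : C -> functor M M)
    (adj : forall c : C, adjunction (section_l (gvm_act M) c) (H c)) c m :
  black_action adj (c, m) = H (dual_ob (gv_duality C) c) m.
Proof. by []. Qed.

Record linear_category (k : fieldType) (C : category) := LinearCategory {
  hom_lmod : forall x y : C, GRing.Lmodule k (Hom x y);
  lhom := fun x y : C => GRing.Lmodule.Pack (hom_lmod x y);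
  comp_linear_l : forall (x y z : C) (f : Hom x y) (a : k) (g g' : lhom y z),
    ((a *: g + g')%R : lhom y z) ∘ f
    = (a *: (g ∘ f : lhom x z) + (g' ∘ f : lhom x z))%R;
  comp_linear_r : forall (x y z : C) (g : Hom y z) (a : k) (f f' : lhom x y),
    g ∘ ((a *: f + f')%R : lhom x y)
    = (a *: (g ∘ f : lhom x z) + (g ∘ f' : lhom x z))%R
}.

Definition bilinear_functor (k : fieldType) (A B C : category)
    (LA : linear_category k A) (LB : linear_category k B)
    (LC : linear_category k C) (T : bifunctor A B C) : Prop :=
  (forall (a a' : A) (b b' : B) (r : k) (f f' : lhom LA a a') (g : Hom b b'),
     @bimap A B C T a a' b b' (r *: f + f')%R g
     = (r *: (bimap T f g : lhom LC _ _) + (bimap T f' g : lhom LC _ _))%R) /\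
  (forall (a a' : A) (b b' : B) (r : k) (f : Hom a a') (g g' : lhom LB b b'),
     @bimap A B C T a a' b b' f (r *: g + g')%R
     = (r *: (bimap T f g : lhom LC _ _) + (bimap T f g' : lhom LC _ _))%R).

(* Main.v *)
Require Import Defs.
From mathcomp Require Import all_boot all_algebra.
From Stdlib Require Import IndefiniteDescription.
(* Makes Hom stand again for the morphisms of a category rather than for the
   linear maps of vector spaces. *)
Import Defs.

(** The action [c ▶ m = H_{Gc} m] arises in two moves, and each move is a
general construction on module categories.

First, passing to right adjoints turns a left action of [(C, ⊗)] on [M] into a
left action of the opposite category with reversed product: [d ▷ (c ▷ -)] has
the right adjoint [H_c ∘ H_d], and the module associator identifies this functor
with [(d ⊗ c) ▷ -], so [H_{d ⊗ c} ≅ H_c ∘ H_d] ([radj_module]).  All coherence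
laws are checked after transposing back along the adjunctions, where they become
laws of [▷].  The pentagon becomes the inverse of the pentagon of [▷]; the
triangle becomes the triangle of [▷] with the unit on the left, which is not an
axiom and is derived by Kelly's argument ([mod_lunit_triangle]).

Second, a module over a monoidal category [B] pulls back along an equivalence
[G : A -> B] to a module over [A] with the transported monoidal structure
([transport_module]).  As [⊙] is by definition the transport of the reversed
product along the duality [G : C -> C^op], the two moves together give the
module structure of [▶].

Left adjoints: [c ▶ -] is [H_{Gc}], right adjoint to [Gc ▷ -].  For [- ▶ m], let
[R_n] be a right adjoint of [- ▷ n]; then
[Hom(n, H_{Gc} m) ≅ Hom(Gc ▷ n, m) ≅ Hom(Gc, R_n m) ≅ Hom(G^-1 (R_n m), c)],
so that [n ↦ G^-1 (R_n m)] is left adjoint ([radj_left_adjoint_r]).  Since [R_n]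
is only known to exist for each [n] separately, the argument goes through
universal arrows ([left_adjoint_of_universal_arrows]).  Limits are preserved
because right adjoints preserve them.

Linearity: [G], [G^-1], the functors [H_c] and the mates are obtained from
inverses of maps built from composition and the given bilinear functors, and the
inverse of a linear bijection is linear ([linear_of_injective_section]). *)

Set Implicit Arguments.
Unset Strict Implicit.
Unset Printing Implicit Defensive.

Local Open Scope cat_scope.

(** * Bifunctors and isomorphisms *)

Section Bifunctors.
Variables (C D E : category) (T : functor (prod_cat C D) E).

Lemma bimapMl (a a' a'' : C) (b : D) (f' : Hom a' a'') (f : Hom a a') :
  bimap T (f' ∘ f) (idm b) = bimap T f' (idm b) ∘ bimap T f (idm b).
Proof. by rewrite -bimapM comp1m. Qed.

Lemma bimapMr (a : C) (b b' b'' : D) (g' : Hom b' b'') (g : Hom b b') :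
  bimap T (idm a) (g' ∘ g) = bimap T (idm a) g' ∘ bimap T (idm a) g.
Proof. by rewrite -bimapM comp1m. Qed.

Lemma bimap_rl (a a' : C) (b b' : D) (f : Hom a a') (g : Hom b b') :
  bimap T (idm a') g ∘ bimap T f (idm b) = bimap T f g.
Proof. by rewrite -bimapM comp1m compm1. Qed.

Lemma bimap_lr (a a' : C) (b b' : D) (f : Hom a a') (g : Hom b b') :
  bimap T f (idm b') ∘ bimap T (idm a) g = bimap T f g.
Proof. by rewrite -bimapM comp1m compm1. Qed.

End Bifunctors.

Lemma iso_epi (C : category) (x y z : C) (i : iso x y) (f g : Hom y z) :
  f ∘ i = g ∘ i -> f = g.
Proof. by move=> e; rewrite -[f]compm1 -[g]compm1 -(bwdK i) !compA e. Qed.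

(** * Adjunctions, limits and universal arrows *)

Section Transposes.
Variables (C D : category) (L : functor C D) (R : functor D C).
Variable adj : adjunction L R.

Definition transp x y (f : Hom (L x) y) : Hom x (R y) :=
  fmap R f ∘ adj_unit adj x.

Definition untransp x y (g : Hom x (R y)) : Hom (L x) y :=
  adj_counit adj y ∘ fmap L g.

Lemma transpK x y : cancel (@transp x y) (@untransp x y).
Proof.
move=> f; rewrite /untransp /transp fmapM compA adj_counit_nat -compA.
by rewrite adj_triangle_l compm1.
Qed.

Lemma untranspK x y : cancel (@untransp x y) (@transp x y).
Proof.
move=> g; rewrite /untransp /transp fmapM -compA -adj_unit_nat compA.
by rewrite adj_triangle_r comp1m.
Qed.

Lemma untransp_natl x x' y (f : Hom x' x) (g : Hom x (R y)) :
  untransp (g ∘ f) = untransp g ∘ fmap L f.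
Proof. by rewrite /untransp fmapM compA. Qed.

Lemma untransp_natr x y y' (h : Hom y y') (g : Hom x (R y)) :
  untransp (fmap R h ∘ g) = h ∘ untransp g.
Proof. by rewrite /untransp fmapM compA adj_counit_nat compA. Qed.

(** Transposition along the adjunction turns a cone over [R ∘ Dg] with vertex [X]
into a cone over [Dg] with vertex [L X]. *)
Lemma right_adjoint_preserves_limits : preserves_limits R.
Proof.
move=> J Dg l p lim_p X q.
have leg_q i j (u : Hom i j) :
  fmap Dg u ∘ untransp (leg q i) = untransp (leg q j).
  by rewrite -untransp_natr -(leg_nat q u).
have [h [hE h_uniq]] := lim_p (L X) (Cone leg_q).
exists (transp h); split=> [j | h' h'E] /=.
  by apply: (can_inj (@untranspK _ _)); rewrite untransp_natr transpK hE.
rewrite -[h']untranspK; congr transp; apply: h_uniq => j /=.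
by rewrite -h'E untransp_natr.
Qed.

End Transposes.

(** Choosing a universal arrow from each object determines [L] on morphisms; this
is what turns a pointwise existence statement into a functor. *)
Lemma left_adjoint_of_universal_arrows (C D : category) (R : functor D C) :
  (forall x : C, exists (y : D) (eta : Hom x (R y)),
     forall (z : D) (f : Hom x (R z)), exists! g : Hom y z, fmap R g ∘ eta = f) ->
  has_left_adjoint R.
Proof.
move=> univ.
pose ob x := proj1_sig (constructive_indefinite_description _ (univ x)).
have univ1 x : exists eta : Hom x (R (ob x)),
    forall (z : D) (f : Hom x (R z)), exists! g : Hom (ob x) z, fmap R g ∘ eta = f.
  exact: proj2_sig (constructive_indefinite_description _ (univ x)).
pose eta x := proj1_sig (constructive_indefinite_description _ (univ1 x)).
have univ2 x (z : D) (f : Hom x (R z)) :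
    exists! g : Hom (ob x) z, fmap R g ∘ eta x = f.
  exact: proj2_sig (constructive_indefinite_description _ (univ1 x)) z f.
pose ext x z (f : Hom x (R z)) : Hom (ob x) z :=
  proj1_sig (constructive_indefinite_description _ (univ2 x z f)).
have extE x z (f : Hom x (R z)) : fmap R (ext x z f) ∘ eta x = f.
  rewrite /ext.
  by case: (constructive_indefinite_description _ (univ2 x z f)) => g [].
have ext_inj x z (g g' : Hom (ob x) z) :
    fmap R g ∘ eta x = fmap R g' ∘ eta x -> g = g'.
  move=> e; have [h [_ h_uniq]] := univ2 x z (fmap R g' ∘ eta x).
  by rewrite -(h_uniq _ e) -(h_uniq g').
pose Lmap x x' (f : Hom x x') := ext x (ob x') (eta x' ∘ f).
have L1 x : Lmap x x (idm x) = idm (ob x).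
  by apply: ext_inj; rewrite extE fmap1 compm1 comp1m.
have LM x y z (g : Hom y z) (f : Hom x y) :
    Lmap x z (g ∘ f) = Lmap y z g ∘ Lmap x y f.
  by apply: ext_inj; rewrite extE fmapM -!compA extE !compA extE.
pose L := Functor L1 LM.
exists L; constructor.
apply: (@Adjunction _ _ L R eta (fun y => ext (R y) y (idm (R y)))).
- by move=> x x' f; rewrite extE.
- move=> y y' g; apply: ext_inj.
  by rewrite !fmapM -!compA !extE compA extE comp1m compm1.
- move=> x; apply: ext_inj.
  by rewrite fmapM -compA extE compA extE fmap1.
- by move=> y; rewrite extE.
Qed.

Lemma has_left_adjoint_preserves_limits (C D : category) (R : functor D C) :
  has_left_adjoint R -> preserves_limits R.
Proof. by case=> L [adj]; exact: right_adjoint_preserves_limits adj. Qed.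

(** * Coherence in module categories *)

Section ModuleTheory.
Variables (C : category) (V : monoidal C) (M : category).
Variables (act : functor (prod_cat C M) M) (S : module_structure V act).

Local Notation "x ⊗ y" := (tensor V (x, y)) (at level 40, left associativity).
Local Notation i := (unit_ob V).

Lemma mod_assoc_bwd_nat (c c' d d' : C) (m m' : M)
    (f : Hom c c') (g : Hom d d') (h : Hom m m') :
  bwd (mod_assoc S c' d' m') ∘ bimap act f (bimap act g h)
  = bimap act (bimap (tensor V) f g) h ∘ bwd (mod_assoc S c d m).
Proof. exact: esym (iso_nat_bwd (mod_assoc_nat S f g h)). Qed.

(** The pentagon solved for the inverse associators, with [assoc] moved to the
other side: this is the form in which the transposed pentagon of the right
adjoints appears. *)
Lemma mod_pentagon_bwd (b c d : C) (m : M) :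
  bimap act (assoc V b c d) (idm m)
    ∘ (bwd (mod_assoc S (b ⊗ c) d m) ∘ bwd (mod_assoc S b c (act (d, m))))
  = bwd (mod_assoc S b (c ⊗ d) m)
    ∘ bimap act (idm b) (bwd (mod_assoc S c d m)).
Proof.
pose p := iso_comp (mod_assoc S b c (act (d, m))) (mod_assoc S (b ⊗ c) d m).
pose q := iso_comp (iso_bimap act (iso_id b) (mod_assoc S c d m))
  (mod_assoc S b (c ⊗ d) m).
apply: (iso_inj (i := q)); rewrite [RHS](bwdK q) compA.
have <- : p = q ∘ bimap act (assoc V b c d) (idm m) :> Hom _ _.
  exact: mod_pentagon.
exact: (bwdK p).
Qed.

Lemma mod_unit_inj (m n : M) (f g : Hom m n) :
  bimap act (idm (unit_ob V)) f = bimap act (idm (unit_ob V)) g -> f = g.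
Proof.
by move=> e; apply: (iso_epi (i := mod_unit S m)); rewrite -!mod_unit_nat e.
Qed.

(** Kelly's argument.  As [1 ▷ -] is faithful, the triangle may be checked after
acting by [1] and after composing with the isomorphism
[((1 ⊗ 1) ⊗ c) ▷ m -> 1 ▷ ((1 ⊗ c) ▷ m)]; the pentagon then reduces both sides to
the triangle axioms of the module and of [V]. *)
Lemma mod_lunit_triangle (c : C) (m : M) :
  mod_unit S (act (c, m)) ∘ mod_assoc S (unit_ob V) c m
  = bimap act (lunit V c) (idm m).
Proof.
apply: mod_unit_inj.
apply: (iso_epi (i := iso_comp (mod_assoc S i (i ⊗ c) m)
  (iso_bimap act (assoc V i i c) (iso_id m)))).
rewrite bimapMr /= -!compA.
have -> : bimap act (idm i) (mod_assoc S i c m) ∘ (mod_assoc S i (i ⊗ c) m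
    ∘ bimap act (assoc V i i c) (idm m))
  = mod_assoc S i i (act (c, m)) ∘ mod_assoc S (i ⊗ i) c m.
  by rewrite mod_pentagon compA.
rewrite compA mod_triangle -(bimap1 act) -mod_assoc_nat compA -mod_assoc_nat.
by rewrite -compA -bimapMl triangle.
Qed.

Lemma mod_lunit_triangle_bwd (c : C) (m : M) :
  bwd (mod_assoc S i c m) ∘ bwd (mod_unit S (act (c, m)))
  = bimap act (bwd (lunit V c)) (idm m).
Proof.
apply: (iso_inj (i := iso_bimap act (lunit V c) (iso_id m))).
rewrite [RHS](bwdK (iso_bimap act (lunit V c) (iso_id m))).
rewrite /= -mod_lunit_triangle.
exact: (bwdK (iso_comp (mod_unit S (act (c, m))) (mod_assoc S i c m))).
Qed.

End ModuleTheory.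

(** * The action by right adjoints *)

Section RightAdjointModule.
Variables (C : category) (V : monoidal C) (M : category).
Variables (act : functor (prod_cat C M) M) (S : module_structure V act).
Variable H : C -> functor M M.
Variable adj : forall c : C, adjunction (section_l act c) (H c).

Local Notation "x ⊗ y" := (tensor V (x, y)) (at level 40, left associativity).
Local Notation hom := (radj_bifunctor adj).
Local Notation "c ▷ f" := (bimap act (idm c) f)
  (at level 35, right associativity).
Local Notation T := (fun c m => adj_counit (adj c) m).

Let flat c n m (f : Hom n (H c m)) : Hom (act (c, n)) m :=
  untransp (adj c) f.
Let sharp c n m (f : Hom (act (c, n)) m) : Hom n (H c m) :=
  transp (adj c) f.

Let sharpK c n m (f : Hom (act (c, n)) m) : flat (sharp f) = f.
Proof. exact: (transpK (adj c) f). Qed.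

Let flat_inj c n m : injective (@flat c n m).
Proof. exact: can_inj (@untranspK _ _ _ _ (adj c) n m). Qed.

Let flatM c n n' m (f : Hom n (H c m)) (g : Hom n' n) :
  flat (f ∘ g) = flat f ∘ c ▷ g.
Proof. exact: (untransp_natl (adj c)). Qed.

Let flat_id c m : flat (idm (H c m)) = T c m.
Proof. by rewrite /flat /untransp fmap1 compm1. Qed.

Let flatE c n m (f : Hom n (H c m)) : flat f = T c m ∘ c ▷ f.
Proof. by []. Qed.

(** By uniqueness of transposes this characterizes [bimap hom f h], so the
coherence proofs below need not unfold mates. *)
Lemma radj_map_counit c c' m m' (f : Hom c' c) (h : Hom m m') :
  T c' m' ∘ c' ▷ (@bimap (op C) M M hom c c' m m' f h)
  = h ∘ T c m ∘ bimap act f (idm (H c m)).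
Proof.
change (flat (fmap (H c') h ∘ mate adj f m)
  = h ∘ T c m ∘ bimap act f (idm (H c m))).
rewrite /flat untransp_natr -compA; congr (_ ∘ _).
exact: mate_counit.
Qed.

Let flat_map c c' n m m' (f : Hom c' c) (h : Hom m m') (k : Hom n (H c m)) :
  flat (@bimap (op C) M M hom c c' m m' f h ∘ k)
  = h ∘ flat k ∘ bimap act f (idm n).
Proof.
by rewrite flatM flatE radj_map_counit flatE -!compA bimap_rl bimap_lr.
Qed.

Let flat2_inj c d n m (f g : Hom n (H c (H d m))) :
  flat (flat f) = flat (flat g) -> f = g.
Proof. by move=> e; do 2 apply: flat_inj. Qed.

(** The mate of the inverse associator [d ▷ (c ▷ -) -> (d ⊗ c) ▷ -], taken between
[H (d ⊗ c)] and the composite right adjoint [H c ∘ H d]. *)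
Definition radj_assoc_fwd c d m : Hom (H (d ⊗ c) m) (H c (H d m)) :=
  sharp (sharp (T (d ⊗ c) m ∘ bwd (mod_assoc S d c (H (d ⊗ c) m)))).

Definition radj_assoc_bwd c d m : Hom (H c (H d m)) (H (d ⊗ c) m) :=
  sharp (flat (T c (H d m)) ∘ mod_assoc S d c (H c (H d m))).

(* In terms of transposes the associator is precomposition with the inverse
   associator of [▷], and likewise for its inverse and for the unit below. *)
Let flat2_assoc c d n m (f : Hom n (H (d ⊗ c) m)) :
  flat (flat (radj_assoc_fwd c d m ∘ f)) = flat f ∘ bwd (mod_assoc S d c n).
Proof.
rewrite flatM sharpK flatM sharpK -compA mod_assoc_bwd_nat bimap1 compA.
by rewrite -flatE.
Qed.

Let flat_assoc_bwd c d n m (f : Hom n (H c (H d m))) :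
  flat (radj_assoc_bwd c d m ∘ f) = flat (flat f) ∘ mod_assoc S d c n.
Proof.
rewrite flatM sharpK -compA -(bimap1 (tensor V)) mod_assoc_nat compA.
by rewrite -flatM.
Qed.

Lemma radj_assocK c d m :
  radj_assoc_bwd c d m ∘ radj_assoc_fwd c d m = idm (H (d ⊗ c) m).
Proof.
apply: flat_inj; rewrite flat_assoc_bwd -[radj_assoc_fwd c d m]compm1.
by rewrite flat2_assoc -compA fwdK compm1.
Qed.

Lemma radj_assoc_bwdK c d m :
  radj_assoc_fwd c d m ∘ radj_assoc_bwd c d m = idm (H c (H d m)).
Proof.
apply: flat2_inj; rewrite flat2_assoc -[radj_assoc_bwd c d m]compm1.
by rewrite flat_assoc_bwd -compA bwdK compm1.
Qed.

Definition radj_assoc (c d : op C) m :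
    iso (hom (tensor (revop_monoidal V) (c, d), m)) (hom (c, hom (d, m))) :=
  @Iso M (H (d ⊗ c) m) (H c (H d m)) _ _ (radj_assocK c d m) (radj_assoc_bwdK c d m).

Definition radj_unit_fwd m : Hom (H (unit_ob V) m) m :=
  T (unit_ob V) m ∘ bwd (mod_unit S (H (unit_ob V) m)).

Definition radj_unit_bwd m : Hom m (H (unit_ob V) m) := sharp (mod_unit S m).

Let radj_unitE n m (f : Hom n (H (unit_ob V) m)) :
  radj_unit_fwd m ∘ f = flat f ∘ bwd (mod_unit S n).
Proof.
by rewrite /radj_unit_fwd -compA -(iso_nat_bwd (mod_unit_nat S f)) compA.
Qed.

Lemma radj_unitK m : radj_unit_bwd m ∘ radj_unit_fwd m = idm (H (unit_ob V) m).
Proof.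
apply: flat_inj; rewrite flatM sharpK mod_unit_nat flat_id.
by rewrite /radj_unit_fwd -compA fwdK compm1.
Qed.

Lemma radj_unit_bwdK m : radj_unit_fwd m ∘ radj_unit_bwd m = idm m.
Proof. by rewrite radj_unitE sharpK bwdK. Qed.

Definition radj_unit m : iso (hom (unit_ob (revop_monoidal V), m)) m :=
  @Iso M (H (unit_ob V) m) m _ _ (radj_unitK m) (radj_unit_bwdK m).

Lemma radj_assoc_nat (c c' d d' : op C) (m m' : M)
    (f : Hom c c') (g : Hom d d') (h : Hom m m') :
  radj_assoc c' d' m' ∘ bimap hom (bimap (tensor (revop_monoidal V)) f g) h
  = bimap hom f (bimap hom g h) ∘ radj_assoc c d m.
Proof.
apply: flat2_inj.
rewrite [LHS]flat2_assoc [in LHS]flatE radj_map_counit [in RHS]flat_map.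
rewrite -[X in _ = flat X]compA flat_map flatM -[fwd (radj_assoc c d m)]compm1.
rewrite [X in _ = _ ∘ (X ∘ _) ∘ _]flat2_assoc flat_id -!compA.
congr (_ ∘ (_ ∘ _)); rewrite bimap_rl.
exact: esym (mod_assoc_bwd_nat S g f _).
Qed.

Lemma radj_unit_nat (m m' : M) (h : Hom m m') :
  radj_unit m' ∘ bimap hom (idm (unit_ob (revop_monoidal V))) h = h ∘ radj_unit m.
Proof.
rewrite [LHS]radj_unitE flatE radj_map_counit bimap1 compm1 -compA.
by [].
Qed.

(** The triple transpose of either side is the counit [T (d ⊗ (c ⊗ b)) m]
precomposed with one side of [mod_pentagon_bwd]. *)
Lemma radj_pentagon (b c d : op C) (m : M) :
  radj_assoc b c (hom (d, m))
    ∘ radj_assoc (tensor (revop_monoidal V) (b, c)) d m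
  = bimap hom (idm b) (radj_assoc c d m)
    ∘ radj_assoc b (tensor (revop_monoidal V) (c, d)) m
    ∘ bimap hom (assoc (revop_monoidal V) b c d) (idm m).
Proof.
do 2 apply: flat_inj; apply: flat_inj.
rewrite [X in flat X = _]flat2_assoc flatM.
rewrite -[fwd (radj_assoc _ d m) in LHS]compm1 [X in X ∘ _ = _]flat2_assoc flat_id.
rewrite -[X in _ = flat (flat (flat X))]compA [X in _ = flat (flat X)]flat_map.
rewrite bimap1 compm1 [RHS]flat2_assoc.
rewrite [X in _ = X ∘ _]flat2_assoc [in RHS]flatE radj_map_counit comp1m.
by rewrite -!compA; congr (_ ∘ _); exact: esym (mod_pentagon_bwd S d c b _).
Qed.

(** The reversed product exchanges the two unitors, so transposing gives the
triangle of [▷] with the unit on the left. *)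
Lemma radj_triangle (c : op C) (m : M) :
  bimap hom (idm c) (radj_unit m) ∘ radj_assoc c (unit_ob (revop_monoidal V)) m
  = bimap hom (runit (revop_monoidal V) c) (idm m).
Proof.
apply: flat_inj; rewrite flat_map [RHS]radj_map_counit bimap1 compm1 comp1m.
rewrite [LHS]radj_unitE -[fwd (radj_assoc _ _ _)]compm1 flat2_assoc flat_id.
rewrite -compA; congr (_ ∘ _).
exact: mod_lunit_triangle_bwd.
Qed.

Definition radj_module : module_structure (revop_monoidal V) hom :=
  @ModuleStructure (op C) (revop_monoidal V) M hom radj_assoc radj_unit
    radj_assoc_nat radj_unit_nat radj_pentagon radj_triangle.

End RightAdjointModule.

(** * Transport of module structures along an equivalence *)

Section ModuleTransport.
Variables (A B N : category) (G : functor A B) (Q : quasi_inverse G).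
Variables (W : monoidal B) (k : A) (u : iso (G k) (unit_ob W)).
Variables (act : functor (prod_cat B N) N) (S : module_structure W act).

Local Notation "X ⊗ Y" := (tensor W (X, Y)) (at level 40, left associativity).
Local Notation "f ⊠ g" := (bimap (tensor W) f g)
  (at level 40, left associativity).
Local Notation ε := (qi_counit Q).
Local Notation tact := (functor_comp act (functor_id_r N G)).

(** The product transported to [A] is [Q (G c ⊗ G d)], and the counit of the
equivalence cancels [G ∘ Q] before the associator of [S] applies. *)
Definition tr_mod_assoc (c d : A) (m : N) :
    iso (tact (tensor (transport_monoidal Q u) (c, d), m)) (tact (c, tact (d, m))) :=
  iso_comp (mod_assoc S (G c) (G d) m)
    (iso_bimap act (ε (G c ⊗ G d)) (iso_id m)).

Definition tr_mod_unit (m : N) : iso (tact (k, m)) m :=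
  iso_comp (mod_unit S m) (iso_bimap act u (iso_id m)).

Lemma tr_mod_assoc_nat (c c' d d' : A) (m m' : N)
    (f : Hom c c') (g : Hom d d') (h : Hom m m') :
  tr_mod_assoc c' d' m' ∘ bimap tact (bimap (tensor (transport_monoidal Q u)) f g) h
  = bimap tact f (bimap tact g h) ∘ tr_mod_assoc c d m.
Proof.
change (mod_assoc S (G c') (G d') m' ∘ bimap act (ε (G c' ⊗ G d')) (idm m')
  ∘ bimap act (fmap G (fmap Q (fmap G f ⊠ fmap G g))) h
  = bimap act (fmap G f) (bimap act (fmap G g) h)
  ∘ (mod_assoc S (G c) (G d) m ∘ bimap act (ε (G c ⊗ G d)) (idm m))).
rewrite -compA -bimapM qi_counit_nat comp1m compA -mod_assoc_nat.
by rewrite -compA -bimapM compm1.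
Qed.

Lemma tr_mod_unit_nat (m m' : N) (h : Hom m m') :
  tr_mod_unit m' ∘ bimap tact (idm k) h = h ∘ tr_mod_unit m.
Proof.
change (mod_unit S m' ∘ bimap act u (idm m') ∘ bimap act (fmap G (idm k)) h
  = h ∘ (mod_unit S m ∘ bimap act u (idm m))).
rewrite fmap1 -compA -bimapM comp1m compm1 compA -mod_unit_nat -compA.
by rewrite -bimapM comp1m compm1.
Qed.

(** Naturality of the counit replaces [G (Q (assoc))] by the associator of [W]
conjugated with counits; the counits cancel and the pentagon of [S] remains. *)
Lemma tr_mod_pentagon (b c d : A) (m : N) :
  tr_mod_assoc b c (tact (d, m))
    ∘ tr_mod_assoc (tensor (transport_monoidal Q u) (b, c)) d m
  = bimap tact (idm b) (tr_mod_assoc c d m)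
    ∘ tr_mod_assoc b (tensor (transport_monoidal Q u) (c, d)) m
    ∘ bimap tact (assoc (transport_monoidal Q u) b c d) (idm m).
Proof.
pose bc := Q (G b ⊗ G c); pose cd := Q (G c ⊗ G d).
pose a x y z : Hom (act (x ⊗ y, z)) (act (x, act (y, z))) := mod_assoc S x y z.
pose e X : Hom (G (Q X)) X := ε X.
have aN x x' y y' z z' (f : Hom x x') (g : Hom y y') (h : Hom z z') :
  a x' y' z' ∘ bimap act (f ⊠ g) h = bimap act f (bimap act g h) ∘ a x y z
  := mod_assoc_nat S f g h.
change (a (G b) (G c) (act (G d, m)) ∘ bimap act (e (G b ⊗ G c)) (idm _)
    ∘ (a (G bc) (G d) m ∘ bimap act (e (G bc ⊗ G d)) (idm m))
  = bimap act (fmap G (idm b))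
       (a (G c) (G d) m ∘ bimap act (e (G c ⊗ G d)) (idm m))
    ∘ (a (G b) (G cd) m ∘ bimap act (e (G b ⊗ G cd)) (idm m))
    ∘ bimap act (fmap G (fmap Q (tr_assoc_aux Q W b c d))) (idm m)).
have auxE : e (G b ⊗ G cd) ∘ fmap G (fmap Q (tr_assoc_aux Q W b c d))
  = (idm (G b) ⊠ bwd (ε (G c ⊗ G d)))
    ∘ (assoc W (G b) (G c) (G d) ∘ (e (G b ⊗ G c) ⊠ idm (G d)))
    ∘ e (G bc ⊗ G d) by exact: qi_counit_nat.
rewrite fmap1 -[RHS]compA -(compA (a (G b) (G cd) m)) -bimapMl auxE.
rewrite bimapMr !bimapMl !compA; congr (_ ∘ _).
rewrite -(bimap1 act) -(compA (a (G b) (G c) _)) -aN compA; congr (_ ∘ _).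
rewrite -(compA _ (a (G b) (G cd) m)) aN !compA.
rewrite -(compA (bimap act (idm (G b)) (a (G c) (G d) m))) -bimapMr.
rewrite -bimapMl (bwdK (ε _)) !bimap1 compm1.
by rewrite (mod_pentagon S).
Qed.

Lemma tr_mod_triangle (c : A) (m : N) :
  bimap tact (idm c) (tr_mod_unit m) ∘ tr_mod_assoc c k m
  = bimap tact (runit (transport_monoidal Q u) c) (idm m).
Proof.
have Er : fmap G (tr_runit Q u c) = tr_runit_aux u c ∘ ε (G c ⊗ G k).
  by rewrite fmapM qi_unit_adjE qi_counit_nat.
change (bimap act (fmap G (idm c)) (mod_unit S m ∘ bimap act u (idm m))
    ∘ (mod_assoc S (G c) (G k) m ∘ bimap act (ε (G c ⊗ G k)) (idm m))
  = bimap act (fmap G (tr_runit Q u c)) (idm m)).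
rewrite Er fmap1 !bimapMl compA; congr (_ ∘ _).
rewrite bimapMr -compA -mod_assoc_nat compA mod_triangle.
by rewrite /= -bimapMl.
Qed.

Definition transport_module : module_structure (transport_monoidal Q u) tact :=
  @ModuleStructure A (transport_monoidal Q u) N tact tr_mod_assoc tr_mod_unit
    tr_mod_assoc_nat tr_mod_unit_nat tr_mod_pentagon tr_mod_triangle.

End ModuleTransport.

(** * Left adjoints in each variable *)

Lemma qi_faithful (A B : category) (G : functor A B) (Q : quasi_inverse G)
    (x y : A) (f g : Hom x y) : fmap G f = fmap G g -> f = g.
Proof.
by move=> e; apply: (iso_inj (i := qi_unit Q y)); rewrite !qi_unit_nat e.
Qed.

Section LeftAdjoints.
Variables (A C M : category) (act : functor (prod_cat C M) M).
Variable H : C -> functor M M.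
Variable adj : forall c : C, adjunction (section_l act c) (H c).
Variable G : functor A (op C).

Local Notation hom := (functor_comp (radj_bifunctor adj) (functor_id_r M G)).

Lemma radj_fmap_l (a : A) (m m' : M) (h : Hom m m') :
  fmap (section_l hom a) h = fmap (H (G a)) h.
Proof.
rewrite -[LHS]/(fmap (H (G a)) h ∘ mate adj (fmap G (idm a)) m).
by rewrite fmap1 mate1 compm1.
Qed.

Lemma radj_left_adjoint_l (a : A) : has_left_adjoint (section_l hom a).
Proof.
exists (section_l act (G a)); constructor.
apply: (@Adjunction M M (section_l act (G a)) (section_l hom a)
  (adj_unit (adj (G a))) (adj_counit (adj (G a)))).
- by move=> x x' f; rewrite radj_fmap_l; exact: (adj_unit_nat (adj (G a)) f).
- by move=> y y' g; rewrite radj_fmap_l; exact: (adj_counit_nat (adj (G a)) g).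
- exact: (adj_triangle_l (adj (G a))).
- by move=> y; rewrite radj_fmap_l; exact: (adj_triangle_r (adj (G a))).
Qed.

(** The universal arrow from [n] has target [Q (R m)], where [R] is right adjoint
to [- ▷ n], and is the transpose of [G (Q (R m)) ▷ n ≅ R m ▷ n -> m].  Under
transposition, composing with it becomes the bijection
[g ↦ e ∘ G g] from [Hom(Q (R m), z)] to [Hom(G z, R m)]. *)
Lemma radj_left_adjoint_r (Q : quasi_inverse G) (m : M) :
  (forall n : M, has_right_adjoint (section_r act n)) ->
  has_left_adjoint (section_r hom m).
Proof.
move=> has_R; apply: left_adjoint_of_universal_arrows => n.
have [R [adjR]] := has_R n.
pose y : A := Q (R m : op C).
pose e : @Hom C (G y) (R m) := bwd (qi_counit Q (R m : op C)).
pose e' : @Hom C (R m) (G y) := fwd (qi_counit Q (R m : op C)).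
have ee' : e ∘ e' = idm (R m) := bwdK (qi_counit Q (R m : op C)).
have e'e : e' ∘ e = idm (G y) := fwdK (qi_counit Q (R m : op C)).
pose ev : Hom (act (G y, n)) m :=
  untransp adjR e.
exists y, (transp (adj (G y)) ev) => z f.
have key (g : Hom y z) :
    untransp (adj (G z)) (fmap (section_r hom m) g ∘ transp (adj (G y)) ev)
    = untransp adjR (e ∘ (fmap G g : @Hom C (G z) (G y))).
  rewrite (untransp_natl adjR) -/ev -[ev in RHS](transpK (adj (G y))).
  rewrite untransp_natl [X in X ∘ _]radj_map_counit comp1m /untransp.
  by rewrite -!compA; congr (_ ∘ _); rewrite bimap_lr bimap_rl.
pose h : @Hom C (G z) (G y) := e' ∘ transp adjR (untransp (adj (G z)) f).
exists (bwd (qi_unit_adj Q z) ∘ fmap Q (h : @Hom (op C) (G y) (G z))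
        ∘ qi_unit_adj Q y).
split=> [|g gE].
  apply: (can_inj (@untranspK _ _ _ _ (adj (G z)) n m)).
  by rewrite key qi_full compA ee' comp1m transpK.
apply: (qi_faithful Q); rewrite qi_full /h.
by rewrite -gE key untranspK compA e'e comp1m.
Qed.

End LeftAdjoints.

(** * Linearity *)

Section Linearity.
Variable k : fieldType.
Local Open Scope ring_scope.

(** Gives linearity of the transpositions, of currying and of the inverse of the
duality, which are all inverses of visibly linear maps. *)
Lemma linear_of_injective_section (U V : lmodType k) (f : U -> V) (g : V -> U) :
  linear g -> injective g -> cancel f g -> linear f.
Proof. by move=> lin_g inj_g fK a u v; apply: inj_g; rewrite lin_g !fK. Qed.

Lemma linear_postcomp (C : category) (L : linear_category k C) (x y z : C)
    (g : Hom y z) : linear ((fun f => g ∘ f) : lhom L x y -> lhom L x z).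
Proof. by move=> a f f'; exact: comp_linear_r. Qed.

Lemma linear_precomp (C : category) (L : linear_category k C) (x y z : C)
    (f : Hom x y) : linear ((fun g => g ∘ f) : lhom L y z -> lhom L x z).
Proof. by move=> a g g'; exact: comp_linear_l. Qed.

Section Duality.
Variables (C : category) (L : linear_category k C) (V : monoidal C) (K : C).
Variables (D : duality V K).
Hypothesis bilV : bilinear_functor L L L (tensor V).

Lemma curry_linear (x y : C) :
  linear (@curry C V K D x y : lhom L (tensor V (x, y)) K -> lhom L x (dual_ob D y)).
Proof.
apply: (@linear_of_injective_section (lhom L (tensor V (x, y)) K)
  (lhom L x (dual_ob D y)) _ (@uncurry C V K D x y)).
- move=> a g g'; rewrite !uncurryE.
  by rewrite [bimap _ _ _]bilV.1 [LHS]linear_postcomp.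
- exact: can_inj (@uncurryK C V K D x y).
- exact: curryK.
Qed.

Lemma dual_map_linear (x y : C) :
  linear (@dual_map C V K D x y : lhom L x y -> lhom L (dual_ob D y) (dual_ob D x)).
Proof.
move=> a f f'.
by rewrite [LHS]/dual_map [bimap _ _ _]bilV.2 [X in curry D X]linear_postcomp
           [LHS]curry_linear.
Qed.

Variable Q : quasi_inverse (dual D).

(** Conjugation by the counit makes the duality into a linear inverse of
[fmap Q]. *)
Lemma dual_inverse_linear (x y : C) :
  linear ((fun f => @fmap _ _ Q (y : op C) x f) : lhom L x y -> lhom L (Q y) (Q x)).
Proof.
pose e z : @Hom C z (dual D (Q z)) := fwd (qi_counit Q (z : op C)).
pose e' z : @Hom C (dual D (Q z)) z := bwd (qi_counit Q (z : op C)).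
have ee' z : e' z ∘ e z = idm z := bwdK (qi_counit Q (z : op C)).
have e'e z : e z ∘ e' z = idm _ := fwdK (qi_counit Q (z : op C)).
pose phi (h : lhom L (Q y) (Q x)) : lhom L x y :=
  e' y ∘ dual_map D h ∘ e x.
apply: (@linear_of_injective_section (lhom L x y) (lhom L (Q y) (Q x)) _ phi).
- move=> a h h'; rewrite /phi [dual_map _ _]dual_map_linear.
  by rewrite [X in X ∘ _]linear_postcomp [LHS]linear_precomp.
- move=> h h' /(congr1 (fun u : Hom x y => e y ∘ u ∘ e' x)).
  rewrite /phi !compA !e'e !comp1m -!compA !e'e !compm1.
  exact: (@qi_faithful _ _ (dual D) Q).
- move=> f; rewrite /phi -compA.
  have -> : dual_map D (fmap Q (f : @Hom (op C) y x)) ∘ e x = e y ∘ f.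
    exact: (qi_counit_nat Q (f : @Hom (op C) y x)).
  by rewrite compA ee' comp1m.
Qed.

Lemma second_monoidal_bilinear :
  bilinear_functor L L L (tensor (second_monoidal Q)).
Proof.
split=> x x' y y' a.
  move=> f f' g.
  rewrite -[LHS]/(@fmap _ _ Q _ _ (bimap (tensor V) (dual_map D g) (dual_map D _))).
  rewrite (dual_map_linear a f f') [bimap _ _ _]bilV.2.
  by rewrite [LHS]dual_inverse_linear.
move=> f g g'.
rewrite -[LHS]/(@fmap _ _ Q _ _ (bimap (tensor V) (dual_map D _) (dual_map D f))).
rewrite (dual_map_linear a g g') [bimap _ _ _]bilV.1.
by rewrite [LHS]dual_inverse_linear.
Qed.

End Duality.

Section Action.
Variables (C M : category).
Variables (LC : linear_category k C) (LM : linear_category k M).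
Variable act : functor (prod_cat C M) M.
Hypothesis bil : bilinear_functor LC LM LM act.
Variable H : C -> functor M M.
Variable adj : forall c : C, adjunction (section_l act c) (H c).

Lemma transp_linear (c : C) (n m : M) :
  linear (@transp _ _ _ _ (adj c) n m
    : lhom LM (act (c, n)) m -> lhom LM n (H c m)).
Proof.
apply: (@linear_of_injective_section (lhom LM (act (c, n)) m)
  (lhom LM n (H c m)) _ (@untransp _ _ _ _ (adj c) n m)).
- by move=> a g g'; rewrite [LHS]/untransp [fmap _ _]bil.2 [LHS]linear_postcomp.
- exact: can_inj (@untranspK _ _ _ _ (adj c) n m).
- exact: (@transpK _ _ _ _ (adj c) n m).
Qed.

Lemma mate_linear (c d : C) (m : M) :
  linear ((fun f => mate adj f m) : lhom LC c d -> lhom LM (H d m) (H c m)).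
Proof.
move=> a f f'.
rewrite -[LHS]/(transp (adj c) (adj_counit (adj d) m ∘ bimap act _ _)).
by rewrite [bimap _ _ _]bil.1 [X in transp _ X]linear_postcomp [LHS]transp_linear.
Qed.

(** [H_c h] is the transpose of [h ∘ T], hence linear in [h]. *)
Lemma radj_fmap_linear (c : C) (m n : M) :
  linear (@fmap _ _ (H c) m n : lhom LM m n -> lhom LM (H c m) (H c n)).
Proof.
have E h : fmap (H c) h = transp (adj c) (h ∘ adj_counit (adj c) m).
  rewrite -[LHS](untranspK (adj c)) -[fmap _ h]compm1 untransp_natr.
  by rewrite /untransp fmap1 compm1.
by move=> a h h'; rewrite !E [X in transp _ X]linear_precomp [LHS]transp_linear.
Qed.

End Action.
End Linearity.

Lemma black_action_bilinear (C : GV_category) (M : GV_module C)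
    (H : C -> functor M M)
    (adj : forall c : C, adjunction (section_l (gvm_act M) c) (H c))
    (k : fieldType) (LC : linear_category k C) (LM : linear_category k M) :
  bilinear_functor LC LC LC (tensor (gv_monoidal C)) ->
  bilinear_functor LC LM LM (gvm_act M) ->
  bilinear_functor LC LM LM (black_action adj).
Proof.
move=> bilV bil; pose G := @dual_map _ _ _ (gv_duality C).
split=> c c' m m' a.
  move=> f f' g.
  rewrite -[LHS]/(fmap (H _) g ∘ mate adj (G _ _ (a *: f + f')%R) m).
  rewrite /G (dual_map_linear (gv_duality C) bilV a f f').
  rewrite [X in _ ∘ X](mate_linear bil adj m a (dual_map _ f) (dual_map _ f')).
  by rewrite [LHS]linear_postcomp.
move=> f g g'.
rewrite -[LHS]/(fmap (H _) (a *: g + g')%R ∘ mate adj (G _ _ f) m).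
by rewrite (radj_fmap_linear bil adj _ a g g') [LHS]linear_precomp.
Qed.

(** * The second module structure *)

Theorem proposition3p5
    (C : GV_category) (Ginv : quasi_inverse (gv_dual C))
    (M : GV_module C)
    (H : forall c : C, functor M M)
    (adj : forall c : C, adjunction (section_l (gvm_act M) c) (H c)) :
  [/\ forall c : C,
        has_left_adjoint (section_l (black_action adj) c) /\
        preserves_limits (section_l (black_action adj) c),
      forall m : M,
        has_left_adjoint (section_r (black_action adj) m) /\
        preserves_limits (section_r (black_action adj) m),
      inhabited (module_structure (gv_second Ginv) (black_action adj)) &
      forall (k : fieldType)
        (LC : linear_category k C) (LM : linear_category k M),
        bilinear_functor LC LC LC (tensor (gv_monoidal C)) ->
        bilinear_functor LC LM LM (gvm_act M) ->
        bilinear_functor LC LC LC (tensor (gv_second Ginv)) /\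
        bilinear_functor LC LM LM (black_action adj)].
Proof.
have adj_l c : has_left_adjoint (section_l (black_action adj) c).
  exact: radj_left_adjoint_l.
have adj_r m : has_left_adjoint (section_r (black_action adj) m).
  apply: (radj_left_adjoint_r adj Ginv); exact: gvm_radj_r.
split.
- by move=> c; split=> //; exact: has_left_adjoint_preserves_limits.
- by move=> m; split=> //; exact: has_left_adjoint_preserves_limits.
- constructor; apply: transport_module.
  exact: (radj_module (gvm_structure M) adj).
- move=> k LC LM bilV bil; split; first exact: second_monoidal_bilinear.
  exact: black_action_bilinear.
Qed.
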